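(* For every Garside group $A$ (the group of fractions of a Garside monoid $A^+$), the quasi-centralizer $QZ(A)=\{g\in A\mid gA^+=A^+g\}$ is a finitely generated free commutative group.
   Context: In a monoid, $v$ left-divides $w$ if $w=vu$ for some $u$, right-divides $w$ if $w=uv$ for some $u$, and $v$ is a factor of $w$ if $w=w_1vw_2$. A monoid is noetherian if every infinite sequence $(w_i)$ with $w_{i+1}$ a factor of $w_i$ for all $i$ is eventually constant. An atom is an element $\neq 1$ that is not a product of two elements $\neq1$. A monoidal Garside structure is a pair $(A^+,\Delta)$ where $A^+$ is a noetherian, left and right cancellative monoid, $\Delta\in A^+$, there is an automorphism $\Phi$ of $A^+$ with $\Delta\Phi(v)=v\Delta$ for all $v\in A^+$, $A^+$ is a lattice for left-divisibility and a lattice for right-divisibility, and for every atom $v$ there is $\overline v\in A^+$ with $v\overline v=\Delta=\overline v\,\Phi(v)$. Then $A^+$ is called a Garside monoid, and its group of fractions $A$ (in which $A^+$ embeds) a Garside group. The atom set is not assumed finite. Equivalently, $QZ(A)$ consists of the elements of $A$ whose conjugation action permutes the atoms of $A^+$. *)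

(* Defs.v *)
From HB Require Import structures.
From mathcomp Require Import all_boot all_order all_algebra.
From mathcomp Require Import boolp classical_sets.

Set Implicit Arguments.
Unset Strict Implicit.
Unset Printing Implicit Defensive.

Local Open Scope classical_set_scope.
Local Open Scope group_scope.

Section Lattice.
Variables (T : Type) (le : T -> T -> Prop).

Definition is_partial_order : Prop :=
  [/\ forall x, le x x,
      forall x y, le x y -> le y x -> x = y
    & forall x y z, le x y -> le y z -> le x z].

Definition is_sup (x y s : T) : Prop :=
  [/\ le x s, le y s & forall z, le x z -> le y z -> le s z].

Definition is_inf (x y i : T) : Prop :=
  [/\ le i x, le i y & forall z, le z x -> le z y -> le z i].

Definition is_lattice : Prop :=
  is_partial_order /\
  forall x y, (exists s, is_sup x y s) /\ (exists i, is_inf x y i).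

End Lattice.

Section Divisibility.
Variable M : monoidType.
Implicit Types v w : M.

Definition left_divides v w : Prop := exists u, w = v * u.
Definition right_divides v w : Prop := exists u, w = u * v.
Definition is_factor v w : Prop := exists w1 w2, w = w1 * v * w2.

Definition is_atom v : Prop :=
  v <> 1 /\ ~ exists a b, [/\ a <> 1, b <> 1 & v = a * b].

Definition noetherian : Prop :=
  forall w : nat -> M, (forall i, is_factor (w i.+1) (w i)) ->
  exists N, forall i, N <= i -> w i = w N.

Definition left_cancellative : Prop :=
  forall u v w, u * v = u * w -> v = w.

Definition right_cancellative : Prop :=
  forall u v w, v * u = w * u -> v = w.

Definition is_automorphism (Phi : M -> M) : Prop :=
  monoid_morphism Phi /\ bijective Phi.

End Divisibility.

Record garside_structure (M : monoidType) (Delta : M) : Prop := {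
  garside_noetherian : noetherian M;
  garside_left_cancellative : left_cancellative M;
  garside_right_cancellative : right_cancellative M;
  garside_left_lattice : is_lattice (@left_divides M);
  garside_right_lattice : is_lattice (@right_divides M);
  garside_automorphism : exists Phi : M -> M,
    [/\ is_automorphism Phi,
        forall v, Delta * Phi v = v * Delta
      & forall v, is_atom v ->
          exists vbar, v * vbar = Delta /\ vbar * Phi v = Delta]
}.

Definition is_garside_monoid (M : monoidType) : Prop :=
  exists Delta : M, garside_structure Delta.

(* [iota] exhibits [A] as the group of fractions of [M].  When [M] is a Garside
   monoid such a pair exists and is unique up to a unique isomorphism (Ore), and
   writing fractions as [b^-1 * a] instead gives the same notion. *)
Record is_group_of_fractions (M : monoidType) (A : groupType) (iota : M -> A)
    : Prop := {
  fractions_morphism : monoid_morphism iota;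
  fractions_injective : injective iota;
  fractions_surjective : forall g : A, exists a b : M, g = iota a * (iota b)^-1
}.

Definition quasi_centralizer (M : monoidType) (A : groupType) (iota : M -> A)
    : set A :=
  [set g | [set g * x | x in range iota] = [set x * g | x in range iota]].

(* A set of this form is automatically a subgroup, being the image of a group
   morphism; it is isomorphic to Z^n. *)
Definition is_fg_free_commutative (A : groupType) (S : set A) : Prop :=
  exists (n : nat) (phi : 'rV[int]_n -> A),
    [/\ forall x y, phi (x + y)%R = phi x * phi y,
        injective phi
      & range phi = S].

(* Main.v *)
(* Write [x <= y] when [x^-1 * y] lies in the monoid [P]. On the quasi-central
   elements of [P] this order is invariant under left and right translations,
   has no infinite descending chain, and has joins: if [xP = Px] and [yP = Py]
   then the left and right lcm of [x] and [y] agree, so the lcm is again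
   quasi-central. As in Birkhoff's theorem on lattice-ordered groups, its atoms
   are therefore central, prime and generating, which gives unique
   factorization. Each such atom [p] divides Delta, for otherwise their lcm
   would be [p Delta], although [p] and Delta have a common divisor in [P]. So
   the atoms are the prime factors of Delta, and they are finite in number. *)

Require Import Defs.
From mathcomp Require Import all_boot all_order all_algebra.
From mathcomp Require Import boolp classical_sets.
From mathcomp Require Import zify.

Set Implicit Arguments.
Unset Strict Implicit.
Unset Printing Implicit Defensive.

Import GRing.Theory.

Local Open Scope classical_set_scope.
Local Open Scope group_scope.

(** * Factor induction and atoms in noetherian cancellative monoids *)

Section Noetherian.
Variable M : monoidType.
Hypothesis noethM : noetherian M.
Implicit Types v w x y : M.

(** The sequence alternating between [v] and [w] is a factor chain, so it becomes stationary. *)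
Lemma is_factor_antisym v w : is_factor v w -> is_factor w v -> v = w.
Proof.
move=> vw wv.
have [i|N stable] := noethM (w := fun i => if odd i then v else w).
  by rewrite /=; case: (odd i).
have := stable N.+1 (leqnSn N); by rewrite /=; case: (odd N).
Qed.

(** Otherwise every counterexample has a different counterexample as a factor, and iterating a
    choice of these gives a chain that never stabilizes. *)
Lemma is_factor_ind (R : M -> Prop) :
  (forall x, (forall y, is_factor y x -> y <> x -> R y) -> R x) ->
  forall x, R x.
Proof.
move=> step x0; apply: contrapT => Rx0.
have next (u : {x | ~ R x}) :
    exists v : {x | ~ R x}, is_factor (sval v) (sval u) /\ sval v <> sval u.
  case: u => x Rx /=; apply: contrapT => none; apply/Rx/step => y yx neq.
  by apply: contrapT => Ry; apply: none; exists (exist _ y Ry).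
have [f fP] := choice next.
pose u n := iter n f (exist _ x0 Rx0).
have [i|N stable] := noethM (w := fun i => sval (u i)).
  exact: (fP (u i)).1.
exact: (fP (u N)).2 (stable N.+1 (leqnSn N)).
Qed.

Hypothesis cancM : left_cancellative M.

Lemma mulm_eql x y : x * y = x -> y = 1.
Proof. by move=> e; apply: (cancM (u := x)); rewrite e mulg1. Qed.

Hypothesis rcancM : right_cancellative M.

Lemma mulm_eqr x y : x * y = y -> x = 1.
Proof. by move=> e; apply: (rcancM (u := y)); rewrite e mul1g. Qed.

(** By cancellation, both factors of a nontrivial splitting are proper, so factor induction applies
    to them. *)
Lemma atoms_ind (R : M -> Prop) :
  R 1 -> (forall a, is_atom a -> R a) ->
  (forall x y, R x -> R y -> R (x * y)) -> forall x, R x.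
Proof.
move=> R1 Ra RM; elim/is_factor_ind => x IH.
have [->//|x1] := pselect (x = 1).
have [ax|] := pselect (is_atom x); first exact: Ra.
move=> /not_andP[//|/contrapT[y [z [y1 z1 xE]]]].
rewrite xE; apply: RM; apply: IH; rewrite xE.
- by exists 1, z; rewrite mul1g.
- by move=> /esym/mulm_eql.
- by exists y, 1; rewrite mulg1.
- by move=> /esym/mulm_eqr.
Qed.

Lemma atom_left_divides x : x <> 1 -> exists2 a, is_atom a & left_divides a x.
Proof.
elim/atoms_ind: x => [//|a aP _|x y IHx IHy].
  by exists a => //; exists 1; rewrite mulg1.
have [->|/IHx[a aP [z ->]] _] := pselect (x = 1); first by rewrite mul1g.
by exists a => //; exists (z * y); rewrite mulgA.
Qed.

End Noetherian.

(** * Integer powers in a group *)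

Section IntegerPowers.
Variable A : groupType.
Implicit Types (x y : A) (a b : int).

Definition pos_part a : nat := if a is Posz n then n else 0.
Definition neg_part a : nat := if a is Negz n then n.+1 else 0.

Definition zexpg x a := x ^+ pos_part a / x ^+ neg_part a.

(** Allowing an arbitrary difference yields additivity: adding the parts of two integers need not
    give the parts of their sum. *)
Lemma zexpgE x m n : zexpg x (m%:Z - n%:Z)%R = x ^+ m / x ^+ n.
Proof.
rewrite /zexpg; move aE: (_ - _)%R => a.
have e : pos_part a + n = m + neg_part a by case: a aE => k /=; lia.
apply: (mulIg (x ^+ neg_part a)); rewrite mulgVK -mulgA.
have -> : (x ^+ n)^-1 * x ^+ neg_part a = x ^+ neg_part a / x ^+ n.
  by apply/commute_sym/commuteV/commuteX2/commute_refl.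
by rewrite mulgA -expgnDr -e expgnDr mulgK.
Qed.

Lemma int_parts a : a = ((pos_part a)%:Z - (neg_part a)%:Z)%R.
Proof. by case: a => n /=; lia. Qed.

Lemma zexpgD x a b : zexpg x (a + b)%R = zexpg x a * zexpg x b.
Proof.
rewrite {1}(int_parts a) {1}(int_parts b) addrACA -opprD -!PoszD zexpgE.
rewrite [in X in _ / X]addnC !expgnDr invgM /zexpg -!mulgA; congr (_ * _).
rewrite !mulgA; congr (_ * _).
by apply/commuteV/commuteX2/commute_refl.
Qed.

Lemma commute_zexpg x y a b : commute x y -> commute (zexpg x a) (zexpg y b).
Proof.
move=> xy; apply: commuteM; last apply: commuteV; apply: commute_sym;
  by apply: commuteM; last apply: commuteV; apply/commuteX2/commute_sym.
Qed.

End IntegerPowers.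

(** * Prime factorization of quasi-central elements *)

Section Cone.
Variables (A : groupType) (P : A -> Prop).
Implicit Types g p x y z : A.

(* [P] stands for the monoid inside its group of fractions, so [P (x^-1 * y)]
   reads "x left-divides y" and [P (y * x^-1)] reads "x right-divides y". *)
Definition normalizes g := forall x, P x <-> P (x ^ g).

Definition quasi_central x := P x /\ normalizes x.

(** Irreducible among quasi-central elements only; such a [p] may still split in [P]. *)
Definition quasi_central_atom p :=
  [/\ quasi_central p, p <> 1 & forall x y,
      quasi_central x -> quasi_central y -> p = x * y -> x = 1 \/ y = 1].

(* [coneVJ] says that [x * y] left-divides [y] only for [x = 1]. The lcm in
   [cone_join] is one in [P], not merely among quasi-central elements: this is
   what forces atoms to divide [D]. *)
Record garside_cone (D : A) : Prop := {
  cone1 : P 1;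
  coneM : forall x y, P x -> P y -> P (x * y);
  coneVJ : forall x y, P x -> P y -> P (x^-1 ^ y) -> x = 1;
  cone_ind : forall R : A -> Prop,
    (forall x, P x -> (forall a y b, P a -> P y -> P b -> x = a * y * b ->
                       y <> x -> R y) -> R x) ->
    forall x, P x -> R x;
  cone_join : forall x y, quasi_central x -> quasi_central y ->
    exists s, [/\ quasi_central s, P (x^-1 * s), P (y^-1 * s) &
      forall z, P (x^-1 * z) -> P (y^-1 * z) -> P (s^-1 * z)];
  cone_quasi_central : quasi_central D;
  cone_divisor : forall x, P x -> x <> 1 ->
    exists a, [/\ P a, a <> 1, P (a^-1 * x), P (a^-1 * D) & P (D * a^-1)];
  cone_directed : forall g, exists k, P (g * D ^+ k)
}.

Lemma normalizes1 : normalizes 1.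
Proof. by move=> x; rewrite conjg1. Qed.

Lemma normalizesM g h : normalizes g -> normalizes h -> normalizes (g * h).
Proof. by move=> Ng Nh x; rewrite conjgM -Nh. Qed.

Lemma normalizesV g : normalizes g -> normalizes g^-1.
Proof. by move=> Ng x; rewrite (Ng (x ^ g^-1)) conjgKV. Qed.

Lemma normalizesX g n : normalizes g -> normalizes (g ^+ n).
Proof.
move=> Ng; elim: n => [|n IH]; first exact: normalizes1.
by rewrite expgS; apply: normalizesM.
Qed.

Variable D : A.
Hypothesis coneP : garside_cone D.
Local Notation Q := quasi_central.
Local Notation atom := quasi_central_atom.

Lemma quasi_central1 : Q 1.
Proof. by split; [exact: cone1 coneP|exact: normalizes1]. Qed.

Lemma quasi_centralM x y : Q x -> Q y -> Q (x * y).
Proof.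
by move=> [Px Nx] [Py Ny]; split; [exact: (coneM coneP)|exact: normalizesM].
Qed.

Lemma quasi_centralX x n : Q x -> Q (x ^+ n).
Proof.
move=> [Px Nx]; split; last exact: normalizesX.
elim: n => [|n IH]; first exact: cone1 coneP.
by rewrite expgS; apply: (coneM coneP).
Qed.

Lemma quasi_centralJ x g : Q x -> normalizes g -> Q (x ^ g).
Proof.
move=> [Px Nx] Ng; split; first by rewrite -Ng.
by apply: normalizesM; [exact: normalizesV|exact: normalizesM].
Qed.

Lemma quasi_centralVM x y : Q x -> Q y -> P (x^-1 * y) -> Q (x^-1 * y).
Proof.
by move=> [_ Nx] [_ Ny] Pxy; split=> //; apply: normalizesM (normalizesV Nx) Ny.
Qed.

(* The join of [p] and [x] lies below [p * x = x * p ^ x], so [p] being an atom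
   it is [x] or [p * x]; comparing with [x * p] then yields commutation. *)
Lemma atom_join p x : atom p -> Q x -> ~ P (p^-1 * x) ->
  p * x = x * p /\
  forall z, P (p^-1 * z) -> P (x^-1 * z) -> P ((p * x)^-1 * z).
Proof.
move=> [Qp p1 pat] Qx npx.
have [s [Qs ps xs smin]] := cone_join coneP Qp Qx.
have Qpx : Q (p ^ x) by apply: quasi_centralJ => //; case: Qx.
have sE : s = p * x.
  pose c := x^-1 * s.
  have Qc : Q c by apply: quasi_centralVM.
  have Pd : P (s^-1 * (p * x)).
    by apply: smin; [rewrite mulKg; case: Qx|case: Qpx].
  have Qd : Q (s^-1 * (p * x)).
    by apply: quasi_centralVM => //; apply: quasi_centralM.
  have Qx' : Q (c ^ x^-1).
    by apply: quasi_centralJ => //; apply: normalizesV; case: Qx.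
  have Qd' : Q ((s^-1 * (p * x)) ^ x^-1).
    by apply: quasi_centralJ => //; apply: normalizesV; case: Qx.
  (* Undoes the conjugation by [x] in the factorization [p ^ x = c * (s^-1 * (p * x))]. *)
  have pE : p = c ^ x^-1 * (s^-1 * (p * x)) ^ x^-1.
    by rewrite -conjMg /c mulgA mulgK conjgK.
  have [/eqP|/eqP] := pat _ _ Qx' Qd' pE; rewrite conjg_eq1 => /eqP e.
    by case: npx; rewrite -[X in _ * X]mulg1 -e mulVKg.
  by rewrite -[RHS](mulVKg s) e mulg1.
rewrite sE in smin; split=> //.
have Qe : Q ((p * x)^-1 * (x * p)).
  apply: quasi_centralVM; try exact: quasi_centralM.
  apply: smin; last by rewrite mulKg; case: Qp.
  by case: (quasi_centralJ Qx (proj2 Qp)).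
have pE : p = p ^ x * ((p * x)^-1 * (x * p)).
  by rewrite /conjg invgM !mulgA !mulgK mulVg mul1g.
have [/eqP|e] := pat _ _ Qpx Qe pE; first by rewrite conjg_eq1 => /eqP.
by rewrite -[RHS](mulVKg (p * x)) e mulg1.
Qed.

(** If [p] does not divide [x], use [atom_join]; otherwise pass to the proper factor [p^-1 * x]. *)
Lemma atom_commute p x : atom p -> Q x -> commute p x.
Proof.
move=> pat Qx; have [Px _] := Qx; move: x Px Qx.
apply: (cone_ind coneP) => x Px IH Qx.
have [px|npx] := pselect (P (p^-1 * x)); last by case: (atom_join pat Qx npx).
have [Qp p1 _] := pat.
have Qy : Q (p^-1 * x) by apply: quasi_centralVM.
have cpy : commute p (p^-1 * x).
  apply: (IH p (p^-1 * x) 1) => //; first by case: Qp.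
  - exact: cone1 coneP.
  - by rewrite mulg1 mulVKg.
  - move=> /(canRL (mulgK _)); rewrite mulgV => /eqP.
    by rewrite invg_eq1 => /eqP.
by rewrite -[x](mulVKg p); apply: commuteM.
Qed.

(** If [p] does not divide [x], then [x * y] is a common multiple of [p] and [x], hence of
    [p * x = x * p]; cancel [x]. *)
Lemma atom_prime p x y : atom p -> Q x -> Q y -> P (p^-1 * (x * y)) ->
  P (p^-1 * x) \/ P (p^-1 * y).
Proof.
move=> pat Qx Qy pxy.
have [|npx] := pselect (P (p^-1 * x)); [by left|right].
have [-> /(_ (x * y) pxy)] := atom_join pat Qx npx.
by rewrite invgM mulKg -mulgA mulKg; apply; case: Qy.
Qed.

Lemma atom_dvd_neq1 p : atom p -> ~ P (p^-1 * 1).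
Proof.
move=> [[Pp _] p1 _]; rewrite mulg1 => PVp; apply: p1.
by apply: (coneVJ coneP Pp (cone1 coneP)); rewrite conjg1.
Qed.

Lemma atom_dvd_atom p q : atom p -> atom q -> P (p^-1 * q) -> p = q.
Proof.
move=> [Qp p1 _] [Qq _ qat] pq.
have qE : q = p * (p^-1 * q) by rewrite mulVKg.
have [//|e] := qat _ _ Qp (quasi_centralVM Qp Qq pq) qE.
by rewrite qE e mulg1.
Qed.

Lemma atom_dvd_expg p q n :
  atom p -> atom q -> P (p^-1 * q ^+ n) -> 0 < n /\ p = q.
Proof.
move=> pat qat; have [Qq _ _] := qat.
elim: n => [/(atom_dvd_neq1 pat)//|n IH]; rewrite expgS.
move=> /(atom_prime pat Qq (quasi_centralX n Qq))[|/IH[_]//].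
by move=> /(atom_dvd_atom pat qat).
Qed.

Lemma quasi_central_prod (I : eqType) (r : seq I) (F : I -> A) :
  (forall i, i \in r -> Q (F i)) -> Q (\prod_(i <- r) F i).
Proof.
move=> QF; rewrite big_seq; apply: (big_ind Q) => //.
  exact: quasi_central1.
exact: quasi_centralM.
Qed.

Lemma atom_dvd_prod (I : eqType) (r : seq I) (F : I -> A) p :
  atom p -> (forall i, i \in r -> Q (F i)) -> P (p^-1 * \prod_(i <- r) F i) ->
  exists2 i, i \in r & P (p^-1 * F i).
Proof.
move=> pat; elim: r => [|i r IH] QF.
  by rewrite big_nil => /(atom_dvd_neq1 pat).
have Qi : Q (F i) by apply: QF; rewrite mem_head.
have Qr j : j \in r -> Q (F j) by move=> jr; apply: QF; rewrite in_cons jr orbT.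
rewrite big_cons.
case/(atom_prime pat Qi (quasi_central_prod Qr)) => [pi|/(IH Qr)[j jr]].
  by exists i; rewrite ?mem_head.
by exists j; rewrite // in_cons jr orbT.
Qed.

Lemma quasi_central_factorization x : Q x ->
  exists2 s : seq A, (forall p, p \in s -> atom p) & x = \prod_(p <- s) p.
Proof.
move=> Qx; have [Px _] := Qx; move: x Px Qx.
apply: (cone_ind coneP) => x Px IH Qx.
have [->|x1] := pselect (x = 1); first by exists [::]; rewrite ?big_nil.
have [xat|] := pselect (atom x).
  by exists [:: x]; rewrite ?big_seq1 // => p; rewrite inE => /eqP->.
move=> /not_and3P[//|//|].
move=> /existsNP[y] /existsNP[z] /not_implyP[Qy] /not_implyP[Qz].
move=> /not_implyP[xE] /not_orP[y1 z1].
have [s sat yE] : exists2 s : seq A,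
    (forall p, p \in s -> atom p) & y = \prod_(p <- s) p.
  apply: (IH 1 y z) => //; rewrite ?mul1g ?xE //; try by case: Qy.
  - exact: cone1 coneP.
  - by case: Qz.
  - by move=> /esym/(canRL (mulKg y)); rewrite mulVg.
have [t tat zE] : exists2 s : seq A,
    (forall p, p \in s -> atom p) & z = \prod_(p <- s) p.
  apply: (IH y z 1) => //; rewrite ?mulg1 ?xE //; try by case: Qy.
  - by case: Qz.
  - exact: cone1 coneP.
  - by move=> /esym/(canRL (mulgK _)); rewrite mulgV.
exists (s ++ t); last by rewrite big_cat -yE -zE.
by move=> p; rewrite mem_cat => /orP[/sat|/tat].
Qed.

(* Otherwise the lcm of [p] and [D] is [D * p]; but if [a <> 1] divides both [p]
   and [D], then [D * (a^-1 * p)] is a strictly smaller common multiple. *)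
Lemma atom_dvd_D p : atom p -> P (p^-1 * D).
Proof.
move=> pat; apply: contrapT => npD.
have [[Pp Np] p1 _] := pat.
have [pD] := atom_join pat (cone_quasi_central coneP) npD.
have [a [Pa a1 ap aD Da]] := cone_divisor coneP Pp p1.
move=> /(_ (D * (a^-1 * p))); rewrite pD invgM mulKg -mulgA mulKg => H.
apply: a1; apply: (coneVJ coneP Pa Pp); apply: H => //.
by rewrite !mulgA -(mulgA p^-1) -mulgA -/(conjg _ _) -Np.
Qed.

Lemma quasi_central_atoms_finite :
  exists2 s : seq A, uniq s & forall p, atom p <-> p \in s.
Proof.
have [s sat DE] := quasi_central_factorization (cone_quasi_central coneP).
exists (undup s); rewrite ?undup_uniq // => p; rewrite mem_undup.
split=> [pat|/sat//].
have := atom_dvd_D pat; rewrite DE.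
case/(atom_dvd_prod pat) => [q /sat[]//|q qs pq].
by rewrite (atom_dvd_atom pat (sat q qs) pq).
Qed.

(** [(F i)^-1] moves past each earlier factor by conjugating it, which keeps that factor in [P]. *)
Lemma dvd_prod (I : eqType) (r : seq I) (F : I -> A) i :
  (forall i, i \in r -> Q (F i)) -> i \in r ->
  P ((F i)^-1 * \prod_(j <- r) F j).
Proof.
elim: r => [//|j r IH] QF.
have Qr k : k \in r -> Q (F k) by move=> kr; apply: QF; rewrite in_cons kr orbT.
rewrite in_cons big_cons => /predU1P[->|ir].
  by rewrite mulKg; case: (quasi_central_prod Qr).
have [Pj _] : Q (F j) by apply: QF; rewrite mem_head.
have [_ Ni] := Qr i ir.
have -> : (F i)^-1 * (F j * \prod_(k <- r) F k)
    = F j ^ F i * ((F i)^-1 * \prod_(k <- r) F k).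
  by rewrite /conjg !mulgA mulgK.
by apply: (coneM coneP); [rewrite -Ni|exact: IH].
Qed.

(** Comparing supports is enough for uniqueness of exponents: the positive and negative parts of an
    integer are never both nonzero. *)
Lemma atom_expg_prod (I : finType) (t : I -> A) (f g : I -> nat) i :
  injective t -> (forall i, atom (t i)) ->
  \prod_i t i ^+ f i = \prod_i t i ^+ g i -> 0 < f i -> 0 < g i.
Proof.
move=> tinj tat fg f_gt0.
have QX (h : I -> nat) j : Q (t j ^+ h j).
  by apply: quasi_centralX; case: (tat j).
have : P ((t i)^-1 * \prod_j t j ^+ g j).
  rewrite -fg -[X in _ * X](mulVKg (t i ^+ f i)) mulgA; apply: (coneM coneP).
    by rewrite -(prednK f_gt0) expgS mulKg; case: (QX (fun i => (f i).-1) i).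
  exact: (dvd_prod (F := fun j => t j ^+ f j)).
case/(atom_dvd_prod (tat i)) => // j _ /(atom_dvd_expg (tat i) (tat j))[].
by move=> + /tinj->.
Qed.

Lemma normalizes_zexpg g a : normalizes g -> normalizes (zexpg g a).
Proof.
by move=> Ng; apply: normalizesM; last apply: normalizesV; apply: normalizesX.
Qed.

Lemma normalizer_fg_free_commutative : is_fg_free_commutative normalizes.
Proof.
have [s s_uniq satE] := quasi_central_atoms_finite.
pose t (i : 'I_(size s)) := nth 1 s i.
have tat i : atom (t i) by apply/satE/mem_nth.
have tinj : injective t.
  by move=> i j /eqP; rewrite nth_uniq // => /eqP/val_inj.
have tC i j : commute (t i) (t j).
  by apply: atom_commute => //; case: (tat j).
pose phi (k : 'rV[int]_(size s)) := \prod_i zexpg (t i) (k 0%R i).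
have phiD (x y : 'rV[int]_(size s)) : phi (x + y)%R = phi x * phi y.
  rewrite -prodgM_commute => [|i j _ _]; last exact: commute_zexpg.
  by apply: eq_bigr => i _; rewrite mxE zexpgD.
have phi0 : phi 0%R = 1.
  by apply: (mulgI (phi 0%R)); rewrite -phiD addr0 mulg1.
have phiN (x : 'rV[int]_(size s)) : phi (- x)%R = (phi x)^-1.
  by apply: (mulgI (phi x)); rewrite -phiD subrr phi0 mulgV.
have phi_eq1 k : phi k = 1 -> k = 0%R.
  move=> phik.
  have e : \prod_i t i ^+ pos_part (k 0%R i)
         = \prod_i t i ^+ neg_part (k 0%R i).
    rewrite -[RHS]mul1g -[X in X * _]phik -prodgM_commute => [|i j _ _].
      by apply: eq_bigr => i _; rewrite mulgVK.
    by apply/commute_sym/commuteM; last apply: commuteV; apply: commuteX2.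
  apply/rowP => i; rewrite mxE.
  have := atom_expg_prod (i := i) tinj tat e.
  have := atom_expg_prod (i := i) tinj tat (esym e).
  by case: (k 0%R i) => [[|n]|n] //=; [move=> _|]; move=> /(_ isT).
exists (size s), phi; split => //.
  move=> x y xy; apply/eqP; rewrite -subr_eq0; apply/eqP/phi_eq1.
  by rewrite phiD phiN xy mulgV.
apply/seteqP; split => [_ [k _ <-]|g Ng].
  apply: (big_ind normalizes); first exact: normalizes1.
    exact: normalizesM.
  by move=> i _; apply: normalizes_zexpg; case: (tat i) => -[].
have Qrange x : Q x -> range phi x.
  case/quasi_central_factorization => r rat ->.
  elim: r rat => [|p r IH] rat; first by exists 0%R; rewrite ?big_nil.
  have [|k _ kE] := IH.
    by move=> q qr; apply: rat; rewrite in_cons qr orbT.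
  have ps : p \in s by apply/satE/rat; rewrite mem_head.
  have pi : index p s < size s by rewrite index_mem.
  (* The basis vector that [phi] sends to [p]. *)
  pose d : 'rV[int]_(size s) := delta_mx 0%R (Ordinal pi).
  exists (d + k)%R => //.
  rewrite big_cons phiD kE; congr (_ * _).
  have dE i : zexpg (t i) (d 0%R i) = p ^+ (i == Ordinal pi).
    rewrite mxE eqxx /=; case: eqVneq => [->|_]; rewrite /zexpg ?divg1 //.
    by rewrite /t nth_index.
  rewrite /phi (eq_bigr _ (fun i _ => dE i)).
  by rewrite prodgXr -big_mkcond big_pred1_eq.
(* This writes [g] as a quotient of two quasi-central elements of [P]. *)
have [k PgD] := cone_directed coneP g.
have QD : Q (D ^+ k) by apply/quasi_centralX/(cone_quasi_central coneP).
have QgD : Q (g * D ^+ k) by split=> //; apply: normalizesM => //; case: QD.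
have [x _ xE] := Qrange _ QgD; have [y _ yE] := Qrange _ QD.
by exists (x - y)%R => //; rewrite phiD phiN xE yE mulgK.
Qed.

End Cone.

(** * A Garside monoid as a cone in its group of fractions *)

Section Garside.
Variables (M : monoidType) (A : groupType) (iota : M -> A) (D : M).
Hypothesis garM : garside_structure D.
Hypothesis fracM : is_group_of_fractions iota.
Implicit Types a b c x y : M.

Local Notation P := (range iota).

Let noethM : noetherian M := garside_noetherian garM.
Let cancM : left_cancellative M := garside_left_cancellative garM.
Let rcancM : right_cancellative M := garside_right_cancellative garM.
Let iotaI : injective iota := fractions_injective fracM.

Let iota1 : iota 1 = 1.
Proof. by case: (fractions_morphism fracM). Qed.

Let iotaM x y : iota (x * y) = iota x * iota y.
Proof. by case: (fractions_morphism fracM) => _ ->. Qed.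

Let iotaX x n : iota (x ^+ n) = iota x ^+ n.
Proof. by elim: n => [//|n IH]; rewrite !expgS iotaM IH. Qed.

Lemma quasi_centralizer_normalizes : quasi_centralizer iota = normalizes P.
Proof.
apply/seteqP; split=> g /=.
  move=> gP x; split=> [Px|[m _ mE]].
    have : [set y * g | y in P] (x * g) by exists x.
    by rewrite -gP => -[y Py yE]; rewrite /conjg -yE mulKg.
  have : [set g * y | y in P] (g * x ^ g) by exists (x ^ g) => //; exists m.
  by rewrite -conjgC gP => -[y Py /mulIg <-].
move=> Ng; apply/seteqP; split=> _ [x Px <-].
  by exists (x ^ g^-1); [rewrite (Ng _) conjgKV|rewrite -conjgCV].
by exists (x ^ g); [rewrite -(Ng _)|rewrite -conjgC].
Qed.

Lemma left_dividesP x y : left_divides x y <-> P ((iota x)^-1 * iota y).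
Proof.
split=> [[u ->]|[u _ uE]]; first by exists u; rewrite // iotaM mulKg.
by exists u; apply: iotaI; rewrite iotaM uE mulVKg.
Qed.

Lemma right_dividesP x y : right_divides x y <-> P (iota y / iota x).
Proof.
split=> [[u ->]|[u _ uE]]; first by exists u; rewrite // iotaM mulgK.
by exists u; apply: iotaI; rewrite iotaM uE mulgVK.
Qed.

Lemma normalizes_left_right x y :
  normalizes P (iota x) -> left_divides x y <-> right_divides x y.
Proof.
move=> Nx; rewrite left_dividesP right_dividesP (Nx (_ / _)).
by rewrite /conjg mulgVK.
Qed.

(** Apply the hypothesis to [m * x] and to [x * m]. Quasi-centrality can thus be tested by
    divisibility inside [M]. *)
Lemma normalizes_of_left_right x :
  (forall y, left_divides x y <-> right_divides x y) -> normalizes P (iota x).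
Proof.
move=> xLR g; split=> [[m _ <-]|[m _ mE]].
  have /xLR/left_dividesP : right_divides x (m * x) by exists m.
  by rewrite iotaM.
have /xLR/right_dividesP : left_divides x (x * m) by exists m.
by rewrite iotaM mE -conjgC mulgK.
Qed.

Lemma normalizes_Delta : normalizes P (iota D).
Proof.
have [Phi [[_ [Psi _ PhiK]] DPhi _]] := garside_automorphism garM.
apply: normalizes_of_left_right => y; split=> -[u ->].
  by exists (Psi u); rewrite -DPhi PhiK.
by exists (Phi u); rewrite DPhi.
Qed.

Lemma divides_Delta_power x : exists k, left_divides x (D ^+ k).
Proof.
elim/(atoms_ind noethM cancM rcancM): x => [|a aat|x y [k [u xk]] [l yl]].
- by exists 0, 1; rewrite mulg1.
- have [Phi [_ _ /(_ a aat) [b [ab _]]]] := garside_automorphism garM.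
  by exists 1%N, b.
(* Moving [u] past [D ^+ l] turns it into [w], so [D ^+ (k + l) = x * D ^+ l * w]. *)
have [w _ wE] : P (iota u ^ iota (D ^+ l)).
  by rewrite iotaX -(normalizesX l normalizes_Delta); exists u.
move/left_dividesP: yl => [v _ vE].
exists (k + l)%N; apply/left_dividesP; exists (v * w) => //.
by rewrite expgnDr xk !iotaM wE vE invgM -!mulgA -conjgC mulKg.
Qed.

Lemma range_garside_cone : garside_cone P (iota D).
Proof.
split.
- by exists 1.
- by move=> _ _ [x _ <-] [y _ <-]; exists (x * y).
- move=> _ _ [x _ <-] [y _ <-] [u _ uE].
  have e : y = x * y * u.
    by apply: iotaI; rewrite !iotaM uE /conjg !mulgA mulgK mulgV mul1g.
  have e' : y = x * y.
    apply: (is_factor_antisym noethM).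
      by exists x, 1; rewrite mulg1.
    by exists 1, u; rewrite mul1g.
  by rewrite (mulm_eqr rcancM (esym e')).
- move=> R step _ [x _ <-]; elim/(is_factor_ind noethM): x => x IH.
  apply: step; first by exists x.
  move=> _ _ _ [a _ <-] [y _ <-] [b _ <-] xE yx; apply: IH.
    by exists a, b; apply: iotaI; rewrite xE !iotaM.
  by move=> e; apply: yx; rewrite e.
- move=> _ _ [[x _ <-] Nx] [[y _ <-] Ny].
  have [_ /(_ x y) [[s [xs ys smin]] _]] := garside_left_lattice garM.
  have [_ /(_ x y) [[r [xr yr rmin]] _]] := garside_right_lattice garM.
  (* Each of [x] and [y] has the same left and right multiples, so [s] and [r] are common multiples
     on both sides and factors of each other. *)
  have sr : s = r.
    have [u rE] : left_divides s r by apply: smin; apply/normalizes_left_right.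
    have [v sE] : right_divides r s by apply: rmin; apply/normalizes_left_right.
    apply: (is_factor_antisym noethM); first by exists 1, u; rewrite mul1g.
    by exists v, 1; rewrite mulg1.
  (* A multiple of [s] on one side is a common multiple of [x] and [y] on both sides, hence a
     multiple of [s = r] on the other side. *)
  have Ns : normalizes P (iota s).
    apply: normalizes_of_left_right => z; split=> -[u ->].
      rewrite [X in right_divides X _]sr.
      apply: rmin; apply/normalizes_left_right => //.
        by case: xs => v ->; exists (v * u); rewrite mulgA.
      by case: ys => v ->; exists (v * u); rewrite mulgA.
    apply: smin; apply/normalizes_left_right => //; rewrite sr.
      by case: xr => v ->; exists (u * v); rewrite mulgA.
    by case: yr => v ->; exists (u * v); rewrite mulgA.
  exists (iota s); split; [by split=> //; exists s|exact/left_dividesP..|].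
  move=> z [u _ uE] yz.
  (* [z] is any group element, but as a multiple of [iota x] it comes from [M], where [smin]
     applies. *)
  have zE : z = iota (x * u) by rewrite iotaM uE mulVKg.
  rewrite zE in yz *; apply/left_dividesP/smin; last exact/left_dividesP.
  by exists u.
- by split; [exists D|exact: normalizes_Delta].
- move=> _ [x _ <-] x1.
  have [|a aat ax] := atom_left_divides noethM cancM rcancM (x := x).
    by move=> e; apply: x1; rewrite e.
  have [Phi [_ _ /(_ a aat) [b [ab _]]]] := garside_automorphism garM.
  have aD : left_divides a D by exists b.
  exists (iota a); split.
  + by exists a.
  + by rewrite -iota1 => /iotaI a1; case: aat.
  + exact/left_dividesP.
  + exact/left_dividesP.
  (* Conjugating by Delta turns [iota D / iota a] into [(iota a)^-1 * iota D]. *)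
  + by rewrite (normalizes_Delta _) conjgE -!mulgA mulKg; apply/left_dividesP.
- move=> g; have [a [b ->]] := fractions_surjective fracM g.
  have [k /left_dividesP[c _ cE]] := divides_Delta_power b.
  by exists k, (a * c); rewrite // iotaM cE iotaX mulgA.
Qed.

End Garside.

Theorem theorem1p2 (M : monoidType) (A : groupType) (iota : M -> A)
  (HM : is_garside_monoid M) (HA : is_group_of_fractions iota) :
  is_fg_free_commutative (quasi_centralizer iota).
Proof.
have [D garM] := HM.
rewrite quasi_centralizer_normalizes.
exact: normalizer_fg_free_commutative (range_garside_cone garM HA).
Qed.
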